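(* Let $1\le k\le r-1$ and $1\le t\le r-1$ be integers, and let $0<p<1$. For all sufficiently large $n$, if $\mathcal{H}\subseteq\binom{[n]}{r}$ is $k$-intersecting, then $$\left\|\mathcal{H}\right\|_{t,p}\le \left\|\mathcal{S}_{n,r,k}\right\|_{t,p}.$$ Moreover, equality holds if and only if $\mathcal{H}$ is isomorphic to $\mathcal{S}_{n,r,k}$.
   Context: $[n]=\{1,\dots,n\}$ and $\binom{[n]}{r}$ is the collection of all $r$-subsets of $[n]$. For a family $\mathcal{H}\subseteq\binom{[n]}{r}$ and $T\subseteq[n]$, $d_{\mathcal{H}}(T)=|\{H\in\mathcal{H}:T\subseteq H\}|$, and $\|\mathcal{H}\|_{t,p}=\sum_{T\in\binom{[n]}{t}}d_{\mathcal{H}}(T)^p$ (with $0^p=0$). $\mathcal{H}$ is $k$-intersecting if $|E\cap F|\ge k$ for all $E,F\in\mathcal{H}$. The full $k$-star is $\mathcal{S}_{n,r,k}=\{H\in\binom{[n]}{r}:[k]\subseteq H\}$. Two families on $[n]$ are isomorphic if a permutation of $[n]$ maps one onto the other. *)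

(* Defs.v *)
From mathcomp Require Import all_boot all_order all_fingroup all_algebra.
From mathcomp Require Import reals exp.

Set Implicit Arguments.
Unset Strict Implicit.
Unset Printing Implicit Defensive.

Import Order.TTheory GRing.Theory Num.Theory.

Local Open Scope ring_scope.

(* The ground set {1, ..., n} is represented by 'I_n = {0, ..., n-1}. *)

Definition subsets_of_size (n r : nat) : {set {set 'I_n}} :=
  [set A : {set 'I_n} | #|A| == r].

Definition degree (n : nat) (H : {set {set 'I_n}}) (T : {set 'I_n}) : nat :=
  #|[set E in H | T \subset E]|.

(* For p != 0 the library's power satisfies 0 `^ p = 0. *)
Definition tp_norm (R : realType) (n : nat) (t : nat) (p : R)
    (H : {set {set 'I_n}}) : R :=
  \sum_(T in subsets_of_size n t) ((degree H T)%:R `^ p).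

Definition k_intersecting (n k : nat) (H : {set {set 'I_n}}) : Prop :=
  forall E F : {set 'I_n}, E \in H -> F \in H -> (k <= #|E :&: F|)%N.

(* The set [k] = {1, ..., k}, as the first k elements of 'I_n. *)
Definition initial_segment (n k : nat) : {set 'I_n} :=
  [set i : 'I_n | (i < k)%N].

Definition full_star (n r k : nat) : {set {set 'I_n}} :=
  [set A in subsets_of_size n r | initial_segment n k \subset A].

Definition isomorphic (n : nat) (F G : {set {set 'I_n}}) : Prop :=
  exists s : {perm 'I_n}, [set s @: A | A : {set 'I_n} in F] = G.

(* Main.v *)
Require Import Defs.
From mathcomp Require Import all_boot all_order all_fingroup all_algebra.
From mathcomp Require Import reals exp.
From mathcomp Require Import zify.

Set Implicit Arguments.
Unset Strict Implicit.
Unset Printing Implicit Defensive.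

Import Order.TTheory GRing.Theory Num.Theory.

Local Open Scope ring_scope.

(** Call the family of all r-sets that contain a fixed k-set K the star of K.
    A k-intersecting family H either lies in a star or it is small, and both
    cases are favourable.

    If H lies in the star of K, then the norm of H is at most that of the star,
    because p > 0, and strictly less when an r-set E of the star is missing
    from H: the degree of any t-set inside E drops ([tp_norm_proper]).  All
    stars are isomorphic, and the norm is an isomorphism invariant, so this
    case gives the inequality together with its equality case.

    If H lies in no star, it has only O(n^(r-k-1)) members, a factor of n fewer
    than a star ([nontrivial_intersecting_bound]).  The number of members is
    the degree sum up to the factor 'C(r, t), and for p < 1 the map d |-> d^p is
    concave, so a small degree sum forces a small norm.  Put j = min(t, r-k).
    A star has of the order of n^j sets T of size t that meet K in exactly
    t-j points, each of degree of the order of n^(r-k-j), so its norm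
    is at least a constant times n^j (n^(r-k-j))^p ([tp_norm_star_ge]).
    With a degree sum of order n^(r-k-1), a norm is smaller than this
    by a factor of order n^p at least ([tp_norm_le_of_degree_sum]): if t < r-k,
    the worst case is a degree sum spread evenly over all t-sets, where every
    degree is smaller by a factor of order n, and if t >= r-k, the bound
    d^p <= d saves a factor of order n.  For large n the factor n^p
    beats all constants. *)

(** * Counting sets that contain a given set *)

Definition star (n r : nat) (U : {set 'I_n}) : {set {set 'I_n}} :=
  [set A in subsets_of_size n r | U \subset A].

Lemma in_star n r (U A : {set 'I_n}) :
  (A \in star r U) = (#|A| == r) && (U \subset A).
Proof. by rewrite !inE. Qed.

Lemma card_star n r (U : {set 'I_n}) :
  (#|U| <= r)%N -> #|star r U| = 'C(n - #|U|, r - #|U|).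
Proof.
move=> leUr.
have cardC : #|~: U| = (n - #|U|)%N by rewrite cardsCs setCK card_ord.
rewrite -cardC -cards_draws.
rewrite -(card_in_imset (f := fun B : {set 'I_n} => U :|: B)
  (D := [set B : {set 'I_n} | B \subset ~: U & #|B| == (r - #|U|)%N])); last first.
  have removeU (B : {set 'I_n}) : B \subset ~: U -> (U :|: B) :\: U = B.
    by move=> sB; rewrite setDUl setDv set0U setDE; apply/setIidPl.
  move=> A B; rewrite !inE => /andP[sA _] /andP[sB _] eqAB.
  by rewrite -(removeU A sA) eqAB removeU.
congr #|pred_of_set _|; apply/setP=> A; rewrite in_star; apply/andP/imsetP.
- case=> /eqP cA sUA; exists (A :\: U).
    by rewrite inE subsetDr /= cardsDS // cA.
  by rewrite -[LHS](setID A U) (setIidPr sUA).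
- case=> B; rewrite inE => /andP[sB /eqP cB] ->; split; last exact: subsetUl.
  rewrite cardsU cB (_ : U :&: B = set0) ?cards0 ?subn0 ?subnKC //.
  by apply/eqP; rewrite setI_eq0 disjoint_sym disjoints_subset.
Qed.

Lemma bin_le_exp m j : ('C(m, j) <= m ^ j)%N.
Proof.
apply: (@leq_trans (m ^_ j)).
  by rewrite -bin_ffact leq_pmulr ?fact_gt0.
elim: j m => [|j IHj] m; first by rewrite ffactn0.
case: m => [|m]; first by [].
rewrite ffactSS expnS leq_mul // (leq_trans (IHj m)) //.
by case: j {IHj} => // j; rewrite leq_exp2r.
Qed.

Lemma ffact_ge_exp m j : ((m.+1 - j) ^ j <= m ^_ j)%N.
Proof.
elim: j m => [|j IHj] m; first by rewrite ffactn0.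
case: m => [|m]; first by rewrite subSS sub0n exp0n.
by rewrite ffactSS expnS subSS leq_mul // leq_subr.
Qed.

(** A crude constant, the same for all j <= r, with n^j = O('C(m, j)) whenever m
    is n up to a bounded error. *)
Definition bin_factor (r : nat) : nat := (2 ^ r * r`!)%N.

(** As n >= 4r, every factor of the falling factorial m (m-1) ... (m-j+1) is at
    least n / 2. *)
Lemma exp_le_bin_factor r n m j : (j <= r)%N -> (4 * r <= n)%N ->
  (n <= m + r)%N -> (n ^ j <= bin_factor r * 'C(m, j))%N.
Proof.
move=> jr rn nm; rewrite /bin_factor.
apply: (@leq_trans (2 ^ j * m ^_ j)).
  apply: (@leq_trans ((2 * (m.+1 - j)) ^ j)).
    case: j jr => // j jr.
    by rewrite leq_exp2r //; lia.
  by rewrite expnMn leq_mul // ffact_ge_exp.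
rewrite -bin_ffact (mulnC 'C(m, j)) mulnA leq_mul // leq_mul ?leq_exp2l ?leq_fact //.
Qed.

Lemma card_star_le_exp n r (U : {set 'I_n}) :
  (#|U| <= r)%N -> (#|star r U| <= n ^ (r - #|U|))%N.
Proof.
move=> leUr; rewrite card_star //; apply: leq_trans (bin_le_exp _ _) _.
by case: (r - #|U|)%N => // j; rewrite leq_exp2r // leq_subr.
Qed.

(** Double counting of the pairs (T, E) with T a t-subset of a member E. *)
Lemma sum_degree n r t (H : {set {set 'I_n}}) : H \subset subsets_of_size n r ->
  (\sum_(T in subsets_of_size n t) degree H T = #|H| * 'C(r, t))%N.
Proof.
move=> sH; rewrite /degree.
under eq_bigr => T _ do rewrite -sum1_card.
under eq_bigr => T _ do under eq_bigl => E do rewrite inE.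
rewrite (exchange_big_dep (mem H)) /=; last by move=> T E _ /andP[].
rewrite -sum_nat_const; apply: eq_bigr => E EH.
have /eqP <- : #|E| == r by move/(subsetP sH): EH; rewrite inE.
rewrite -cards_draws -sum1_card; apply: eq_bigl => T.
by rewrite !inE EH andbC.
Qed.

(** * Intersecting families contained in no star *)

Lemma card_bigcup_le (I T : finType) (P : pred I) (F : I -> {set T}) c :
  (forall i, P i -> #|F i| <= c)%N ->
  (#|\bigcup_(i | P i) F i| <= #|P| * c)%N.
Proof.
move=> leF; rewrite -sum_nat_const.
elim/big_rec2: _ => [|i m A Pi leA]; first by rewrite cards0.
by rewrite cardsU (leq_trans (leq_subr _ _)) // leq_add ?leF.
Qed.

(** Fix a member E0.  Each member meets E0 in at least k points, so it lies in
    the star of one of the 'C(r, k) k-subsets K of E0.  Since H is not inside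
    that star, some member F does not contain K.  A member E that contains K
    meets F in at least k points, not all of them in K, so E contains K
    and one of the at most r points of F outside K. *)
Lemma nontrivial_intersecting_bound n r k (H : {set {set 'I_n}}) :
  (k < r)%N -> H \subset subsets_of_size n r -> k_intersecting k H ->
  (forall K : {set 'I_n}, #|K| = k -> ~~ (H \subset star r K)) ->
  (#|H| <= 'C(r, k) * (r * n ^ (r - k - 1)))%N.
Proof.
move=> kr sH intH ntH.
have sizeH E : E \in H -> #|E| = r by move/(subsetP sH); rewrite inE => /eqP.
have [->|[E0 E0H]] := set_0Vmem H; first by rewrite cards0.
pose cores := [set K : {set 'I_n} | K \subset E0 & #|K| == k].
have cardK : #|cores| = 'C(r, k) by rewrite cards_draws sizeH.
have coverH : H \subset \bigcup_(K in cores) (H :&: star r K).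
  apply/subsetP=> E EH; have := intH _ _ E0H EH.
  (* A k-element part of E :&: E0 is the required K. *)
  case/card_geqP=> s [us /eqP ss sub_s].
  apply/bigcupP; exists [set x in s].
    rewrite inE cardsE (card_uniqP us) ss andbT.
    by apply/subsetP=> x; rewrite inE => /sub_s /setIP[].
  rewrite inE EH in_star sizeH ?eqxx //=.
  by apply/subsetP=> x; rewrite inE => /sub_s /setIP[].
rewrite -cardK (leq_trans (subset_leq_card coverH)) // card_bigcup_le // => K.
rewrite inE => /andP[_ /eqP cK].
have [F FH KF] : exists2 F, F \in H & ~~ (K \subset F).
  have /subsetPn[F FH] := ntH _ cK.
  by rewrite in_star sizeH // eqxx => KF; exists F.
have cover : H :&: star r K \subset \bigcup_(x in F :\: K) star r (x |: K).
  apply/subsetP=> E /setIP[EH]; rewrite in_star => /andP[cE KE].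
  have /subsetPn[x xEF xK] : ~~ (E :&: F \subset K).
    apply/negP=> sEF; have /eqP eqEF : E :&: F == K.
      by rewrite eqEcard sEF cK intH.
    by case/negP: KF; rewrite -eqEF subsetIr.
  move: xEF; rewrite inE => /andP[xE xF].
  apply/bigcupP; exists x; first by rewrite inE xK.
  by rewrite in_star cE subUset sub1set xE.
rewrite (leq_trans (subset_leq_card cover)) //.
apply: (@leq_trans (#|F :\: K| * n ^ (r - k - 1))).
  apply: card_bigcup_le => x; rewrite inE => /andP[xK _].
  have cxK : #|x |: K| = k.+1 by rewrite cardsU1 xK cK.
  have -> : (r - k - 1 = r - #|x |: K|)%N by rewrite cxK; lia.
  by apply: card_star_le_exp; rewrite cxK.
by rewrite leq_mul // -(sizeH F) // subset_leq_card // subsetDl.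
Qed.

(** * Isomorphism and monotonicity of the norm *)

(** The permutation lists A, then its complement, and maps the i-th element of
    this list to the i-th element of the corresponding list for B. *)
Lemma exists_perm_imset (T : finType) (A B : {set T}) :
  #|A| = #|B| -> exists s : {perm T}, s @: A = B.
Proof.
move=> eqAB; pose e (C : {set T}) := enum C ++ enum (~: C).
have size_e C : size (e C) = #|T| by rewrite size_cat -!cardE cardsC.
have mem_e C x : x \in e C by rewrite mem_cat !mem_enum inE orbN.
have uniq_e C : uniq (e C).
  rewrite cat_uniq !enum_uniq andbT /=; apply/hasPn=> x.
  by rewrite !mem_enum inE.
have lt_e C D x : (index x (e C) < size (e D))%N.
  by rewrite size_e -(size_e C) index_mem.
pose f x := nth x (e B) (index x (e A)).
have injf : injective f.
  move=> x y; rewrite /f (set_nth_default y) // => /eqP.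
  rewrite nth_uniq // => /eqP eqi.
  by rewrite -[x](nth_index x (mem_e A x)) eqi nth_index.
exists (perm injf); apply/eqP.
rewrite eqEcard card_imset; last exact: perm_inj.
rewrite eqAB leqnn andbT; apply/subsetP=> _ /imsetP[x xA ->].
rewrite permE /f /e index_cat mem_enum xA nth_cat.
have lt : (index x (enum A) < size (enum B))%N.
  by rewrite -cardE -eqAB cardE index_mem mem_enum.
by rewrite lt -mem_enum mem_nth.
Qed.

Lemma imset_perm_star n r (s : {perm 'I_n}) (K : {set 'I_n}) :
  [set s @: A | A : {set 'I_n} in star r K] = star r (s @: K).
Proof.
have injs : injective s := @perm_inj _ s.
apply/setP=> B; rewrite in_star; apply/imsetP/andP.
- case=> A; rewrite in_star => /andP[/eqP <- KA] ->.
  by rewrite card_imset // eqxx imsetS.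
- case=> /eqP cB KB; have eqB : B = s @: (s^-1%g @: B).
    rewrite -imset_comp -[LHS]imset_id; apply: eq_imset => x /=.
    by rewrite permKV.
  exists (s^-1%g @: B) => //.
  rewrite in_star card_imset ?cB ?eqxx /=; last exact: perm_inj.
  apply/subsetP=> x xK; apply/imsetP; exists (s x); last by rewrite permK.
  by apply: (subsetP KB); apply: imset_f.
Qed.

Lemma tp_norm_isomorphic (R : realType) n t (p : R) (F G : {set {set 'I_n}}) :
  isomorphic F G -> tp_norm t p F = tp_norm t p G.
Proof.
case=> s <-; have injs : injective s := @perm_inj _ s.
have inj_im := imset_inj injs.
rewrite /tp_norm [RHS](reindex (fun T : {set 'I_n} => s @: T)) /=; last first.
  exists (fun T : {set 'I_n} => s^-1%g @: T) => T _; rewrite -imset_comp;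
  rewrite -[RHS]imset_id; apply: eq_imset => x /=; by rewrite ?permK ?permKV.
apply: eq_big => [T|T _]; first by rewrite !inE card_imset.
congr ((_%:R) `^ p); rewrite /degree -(card_imset _ inj_im).
congr #|pred_of_set _|; apply/setP=> E; rewrite inE; apply/imsetP/andP.
- case=> A; rewrite inE => /andP[AF TA] ->.
  by rewrite imset_f // imsetS.
- case=> /imsetP[A AF ->] sTA; exists A => //; rewrite inE AF.
  apply/subsetP=> x xT; have := subsetP sTA (s x) (imset_f _ xT).
  by rewrite mem_imset.
Qed.

Lemma degree_mono n (F G : {set {set 'I_n}}) T :
  F \subset G -> (degree F T <= degree G T)%N.
Proof.
move=> sFG; apply/subset_leq_card/subsetP=> E; rewrite !inE.
by case/andP=> /(subsetP sFG) -> ->.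
Qed.

Section Norm.
Variables (R : realType) (n t : nat) (p : R).
Hypothesis p_gt0 : 0 < p.

Lemma le_powRn (a b : nat) : (a <= b)%N -> (a%:R : R) `^ p <= b%:R `^ p.
Proof. by move=> ab; rewrite ge0_ler_powR ?nnegrE ?ler0n ?ler_nat // ltW. Qed.

Lemma tp_norm_proper r (F G : {set {set 'I_n}}) :
  (t <= r)%N -> G \subset subsets_of_size n r -> F \proper G ->
  tp_norm t p F < tp_norm t p G.
Proof.
move=> tr sG /properP[sFG [E EG EF]].
have : (0 < #|[set T : {set 'I_n} | T \subset E & #|T| == t]|)%N.
  rewrite cards_draws bin_gt0.
  by have := subsetP sG _ EG; rewrite inE => /eqP ->.
(* Any t-subset T of the missing member E has a smaller degree in F. *)
case/card_gt0P=> T; rewrite inE => /andP[TE cT].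
rewrite /tp_norm (bigD1 T) ?inE //= [ltRHS](bigD1 T) ?inE //=.
apply: ltr_leD; last first.
  by apply: ler_sum => A _; rewrite le_powRn // degree_mono.
rewrite gt0_ltr_powR ?nnegrE ?ler0n // ltr_nat; apply: proper_card.
apply/properP; split; last by exists E; rewrite inE ?EG ?TE // negb_and EF.
by apply/subsetP=> A; rewrite !inE => /andP[/(subsetP sFG) -> ->].
Qed.

(** * Lower bound for the norm of a star *)

Lemma tp_norm_ge_const (H D : {set {set 'I_n}}) c :
  D \subset subsets_of_size n t -> (forall T, T \in D -> c <= degree H T)%N ->
  #|D|%:R * c%:R `^ p <= tp_norm t p H.
Proof.
move=> sD leD; rewrite mulr_natl -sumr_const /tp_norm.
rewrite [leRHS](big_setID D) /= (setIidPr sD).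
apply: (@le_trans _ _ (\sum_(T in D) (degree H T)%:R `^ p)).
  by apply: ler_sum => T TD; rewrite le_powRn ?leD.
by rewrite lerDl sumr_ge0 // => T _; exact: powR_ge0.
Qed.

(** Fix a subset A of K of size t - j.  Every T = A :|: B with B a j-set disjoint
    from K has the degree of B :|: K among all r-sets, as K already contains A,
    and distinct B give distinct T. *)
Lemma tp_norm_star_ge r k j (K : {set 'I_n}) : #|K| = k ->
  (j <= t)%N -> (t - j <= k)%N -> (k + j <= r)%N ->
  'C(n - k, j)%:R * 'C(n - (k + j), r - (k + j))%:R `^ p
    <= tp_norm t p (star r K).
Proof.
move=> cK jt tjk kjr.
have : (0 < #|[set A : {set 'I_n} | A \subset K & #|A| == (t - j)%N]|)%N.
  by rewrite cards_draws bin_gt0 cK.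
case/card_gt0P=> A; rewrite inE => /andP[AK /eqP cA].
pose D0 := [set B : {set 'I_n} | B \subset ~: K & #|B| == j].
have disjK B : B \in D0 -> B :&: K = set0.
  rewrite inE => /andP[sB _]; apply/eqP.
  by rewrite setI_eq0 disjoints_subset.
have removeA B : B \in D0 -> (A :|: B) :\: K = B.
  move=> BD; rewrite setDUl (_ : A :\: K = set0) ?set0U; last first.
    by apply/eqP; rewrite setD_eq0.
  by move: BD; rewrite inE setDE => /andP[sB _]; apply/setIidPl.
have cD0 : #|D0| = 'C(n - k, j).
  by rewrite cards_draws [#|~: K|]cardsCs setCK card_ord cK.
rewrite -cD0 -(card_in_imset (f := fun B : {set 'I_n} => A :|: B) (D := D0));
  last by move=> B C BD CD eqBC; rewrite -(removeA B BD) eqBC removeA.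
apply: tp_norm_ge_const => [|_ /imsetP[B BD ->]].
- apply/subsetP=> _ /imsetP[B BD ->]; rewrite inE cardsU cA.
  have -> : A :&: B = set0.
    by apply/eqP; rewrite -subset0 -(disjK B BD) setIC setIS.
  by move: BD; rewrite inE cards0 subn0 => /andP[_ /eqP ->]; rewrite subnK.
- have cBK : #|B :|: K| = (k + j)%N.
    rewrite cardsU disjK // cards0 subn0 cK addnC.
    by move: BD; rewrite inE => /andP[_ /eqP ->].
  rewrite -cBK -card_star ?cBK // subset_leq_card //.
  apply/subsetP=> E; rewrite in_star subUset => /and3P[cE BE KE].
  by rewrite inE in_star cE KE subUset BE (subset_trans AK KE).
Qed.

(** * Upper bound for the norm of a family with few members *)

Hypothesis p_lt1 : p < 1.

Lemma powRn_le_self (d : nat) : (d%:R : R) `^ p <= d%:R.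
Proof.
case: d => [|d]; first by rewrite powR0 ?gt_eqF.
by rewrite ler1_powR ?ler1n // ltW.
Qed.

(** This is what concavity of the power gives around a typical degree M, with
    looser constants than the tangent line: the first term covers d <= M, the
    second one d > M, where (d / M)^p <= d / M. *)
Lemma powRn_le_affine (M d : nat) : (0 < M)%N ->
  (d%:R : R) `^ p <= M%:R `^ p * (1 + d%:R / M%:R).
Proof.
move=> M0; have M0' : 0 < (M%:R : R) by rewrite ltr0n.
have [dM|Md] := leqP d M.
  apply: le_trans (le_powRn dM) _.
  by rewrite ler_peMr ?powR_ge0 // lerDl divr_ge0 ?ler0n.
have q1 : 1 <= (d%:R / M%:R : R).
  by rewrite ler_pdivlMr // mul1r ler_nat ltnW.
rewrite -{1}[d%:R](divfK (lt0r_neq0 M0')) mulrC powRM ?divr_ge0 ?ler0n //.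
rewrite ler_wpM2l ?powR_ge0 // (le_trans (ler1_powR q1 (ltW p_lt1))) //.
by rewrite lerDr.
Qed.

(** In the application s = r - k.  A star has of the order of n^s members, so
    the hypothesis asks for a factor of n fewer, and the conclusion is then a
    gain of n^p over the order of magnitude of the norm of a star. *)
Lemma tp_norm_le_of_degree_sum r s (H : {set {set 'I_n}}) D :
  (0 < s)%N -> (0 < n)%N -> H \subset subsets_of_size n r ->
  (#|H| * 'C(r, t) <= D * n ^ (s - 1))%N ->
  n%:R `^ p * tp_norm t p H <=
    D.+1%:R * ((n ^ minn t s)%:R * (n ^ (s - minn t s))%:R `^ p).
Proof.
move=> s0 n0 sH; rewrite -(sum_degree t sH) => leH.
have [st|ts] := leqP s t.
- rewrite subnn expn0 powR1 mulr1 -natrM.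
  apply: (@le_trans _ _ (n%:R * (D * n ^ (s - 1))%:R)).
    apply: ler_pM; [exact: powR_ge0 | | exact: powRn_le_self |].
      by apply: sumr_ge0 => T _; exact: powR_ge0.
    rewrite -(ler_nat R) natr_sum in leH; apply: le_trans leH.
    by apply: ler_sum => T _; exact: powRn_le_self.
  rewrite -natrM ler_nat mulnCA -expnS.
  have -> : (s - 1).+1 = s by lia.
  by rewrite leq_mul.
- (* The average degree when the degree sum of order n^(s-1) is spread
     over n^t sets. *)
  pose M := (n ^ (s - t - 1))%N.
  have M0 : (0 < M)%N by rewrite expn_gt0 n0.
  have -> : (n ^ (s - t) = n * M)%N by rewrite -expnS; congr expn; lia.
  have {leH} leH : (\sum_(T in subsets_of_size n t) degree H T <= D * n ^ t * M)%N.
    by rewrite -mulnA -expnD (_ : (t + (s - t - 1) = s - 1)%N) //; lia.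
  rewrite natrM powRM ?ler0n // [leRHS]mulrA [leRHS]mulrC -[leRHS]mulrA.
  rewrite ler_wpM2l ?powR_ge0 //.
  apply: (@le_trans _ _ (\sum_(T in subsets_of_size n t)
     (M%:R `^ p * (1 + (degree H T)%:R / M%:R)))).
    by apply: ler_sum => T _; exact: powRn_le_affine.
  rewrite -mulr_sumr ler_wpM2l ?powR_ge0 // big_split /= -mulr_suml -natr_sum.
  rewrite sumr_const -addn1 natrD mulrDl addrC mul1r lerD //.
    by rewrite ler_pdivrMr ?ltr0n // -!natrM ler_nat.
  rewrite ler_nat card_draws card_ord; exact: bin_le_exp.
Qed.

End Norm.

(** * The comparison for large ground sets *)

Lemma exists_powRn_gt (R : realType) (c p : R) : 0 < p ->
  exists N : nat, forall n : nat, (N <= n)%N -> c < n%:R `^ p.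
Proof.
move=> p0; have [c0|c0] := ltP c 0.
  by exists 0 => n _; apply: lt_le_trans c0 (powR_ge0 _ _).
exists (Num.bound (c `^ p^-1)) => n Nn.
have root_lt : c `^ p^-1 < n%:R.
  by apply: lt_le_trans (archi_boundP (powR_ge0 _ _)) _; rewrite ler_nat.
have -> : c = (c `^ p^-1) `^ p by rewrite -powRrM mulVf ?gt_eqF // powRr1.
by rewrite gt0_ltr_powR ?nnegrE ?powR_ge0 ?ler0n.
Qed.

Lemma card_initial_segment n k : (k <= n)%N -> #|initial_segment n k| = k.
Proof.
move=> kn; rewrite -[RHS](card_ord k).
have inj : injective (widen_ord kn).
  by move=> i j /(congr1 val) /= eqij; apply: val_inj.
rewrite -cardsT -(card_imset _ inj).
congr #|pred_of_set _|; apply/setP=> i; rewrite inE; apply/idP/imsetP.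
  by move=> ik; exists (Ordinal ik); last exact: val_inj.
by case=> j _ ->; rewrite /= ltn_ord.
Qed.

Theorem theorem1p4 (R : realType) (r k t : nat) (p : R)
    (hk : (1 <= k <= r - 1)%N) (ht : (1 <= t <= r - 1)%N)
    (hp : 0 < p < 1) :
  exists n0 : nat, forall n : nat, (n0 <= n)%N ->
    forall H : {set {set 'I_n}},
      H \subset subsets_of_size n r -> k_intersecting k H ->
      tp_norm t p H <= tp_norm t p (full_star n r k) /\
      (tp_norm t p H = tp_norm t p (full_star n r k) <->
       isomorphic H (full_star n r k)).
Proof.
case/andP: hp => p0 p1.
pose b := bin_factor r.
pose D := ('C(r, k) * r * 'C(r, t))%N.
(* D.+1 is lost in the upper bound for H, the factors b and b^p in bounding
   the two binomial coefficients of the lower bound by powers of n. *)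
have [N ltN] := exists_powRn_gt (D.+1%:R * (b%:R * b%:R `^ p)) p0.
exists (N + 4 * r)%N => n nN H sH intH.
have cI : #|initial_segment n k| = k by apply: card_initial_segment; lia.
rewrite -[full_star n r k]/(star r (initial_segment n k)).
set I := initial_segment n k in cI *.
have [/existsP[K /andP[/eqP cK HK]]|/existsPn ntH] :=
    boolP [exists K : {set 'I_n}, (#|K| == k) && (H \subset star r K)].
  have [s sK] : exists s : {perm 'I_n}, s @: K = I.
    by apply: exists_perm_imset; rewrite cK.
  have isoK : isomorphic (star r K) (star r I).
    by exists s; rewrite imset_perm_star sK.
  rewrite -(tp_norm_isomorphic t p isoK).
  have [ltHK|] := boolP (H \proper star r K).
    have lt_norm : tp_norm t p H < tp_norm t p (star r K).
      apply: (tp_norm_proper (r := r) p0 _ _ ltHK); first by lia.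
      by apply/subsetP=> E; rewrite inE => /andP[].
    split; [exact: ltW | split=> [eqn|isoH]].
    - by rewrite eqn ltxx in lt_norm.
    - move: lt_norm; rewrite (tp_norm_isomorphic t p isoH).
      by rewrite (tp_norm_isomorphic t p isoK) ltxx.
  by rewrite properEneq HK andbT negbK => /eqP ->; split.
suff lt_norm : tp_norm t p H < tp_norm t p (star r I).
  split; [exact: ltW | split=> [eqn|isoH]].
  - by rewrite eqn ltxx in lt_norm.
  - by rewrite (tp_norm_isomorphic t p isoH) ltxx in lt_norm.
(* H lies in no star: compare both norms, up to constants, with
   n^j (n^(r-k-j))^p. *)
have n0 : (0 < n)%N by lia.
have leH : (#|H| * 'C(r, t) <= D * n ^ (r - k - 1))%N.
  rewrite /D mulnAC leq_mul // -mulnA.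
  apply: nontrivial_intersecting_bound => //; first by lia.
  by move=> K cK; have := ntH K; rewrite cK eqxx.
have rk0 : (0 < r - k)%N by lia.
have upper := tp_norm_le_of_degree_sum p0 p1 rk0 n0 sH leH.
set j := minn t (r - k) in upper.
have lower : 'C(n - k, j)%:R * 'C(n - (k + j), r - (k + j))%:R `^ p
    <= tp_norm t p (star r I).
  by apply: tp_norm_star_ge => //; rewrite /j; lia.
have powers_le : (n ^ j)%:R * (n ^ (r - k - j))%:R `^ p
    <= b%:R * b%:R `^ p * tp_norm t p (star r I).
  apply: le_trans (ler_wpM2l _ lower); last by rewrite mulr_ge0 ?powR_ge0.
  rewrite mulrACA -powRM ?ler0n // -!natrM.
  apply: ler_pM; rewrite ?ler0n ?powR_ge0 //.
    by rewrite ler_nat exp_le_bin_factor //; rewrite /j; lia.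
  by rewrite le_powRn // -subnDA exp_le_bin_factor //; rewrite /j; lia.
have norm_gt0 : 0 < tp_norm t p (star r I).
  apply: lt_le_trans lower; rewrite mulr_gt0 ?powR_gt0 ?ltr0n ?bin_gt0 //;
  rewrite /j; lia.
have np0 : 0 < (n%:R : R) `^ p by rewrite powR_gt0 ?ltr0n.
rewrite -(ltr_pM2l np0).
apply: (le_lt_trans upper).
apply: (@le_lt_trans _ _ (D.+1%:R * (b%:R * b%:R `^ p) * tp_norm t p (star r I))).
  by rewrite -mulrA ler_wpM2l.
by rewrite ltr_pM2r // ltN //; lia.
Qed.
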